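(* Let $\mathbb{F}$ be either $\mathbb{R}$ or $\mathbb{C}$, and let $M_1$ and $M_2$ be Hausdorff smooth finite-dimensional manifolds. Then for every isomorphism of associative $\mathbb{F}$-algebras $\Phi: C^\infty(M_1;\mathbb{F})\to C^\infty(M_2;\mathbb{F})$ there is a smooth diffeomorphism $\varphi: M_2\to M_1$ such that $\Phi$ is the pullback by $\varphi$, i.e. $\Phi(f)=f\circ\varphi$ for all $f\in C^\infty(M_1;\mathbb{F})$.
   Context: Manifolds are not required to be connected, second countable, or paracompact. $C^\infty(M;\mathbb{F})$ denotes the associative $\mathbb{F}$-algebra (with pointwise operations) of all $\mathbb{F}$-valued smooth functions on $M$. Algebra isomorphisms are $\mathbb{F}$-linear multiplicative bijections; no continuity is assumed. *)

(* Defs.v *)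
From HB Require Import structures.
From mathcomp Require Import all_boot all_order all_algebra.
From mathcomp Require Import all_classical all_reals all_analysis.
From mathcomp Require Import complex.

Set Implicit Arguments.
Unset Strict Implicit.
Unset Printing Implicit Defensive.

Import Order.TTheory GRing.Theory Num.Theory.
Import numFieldNormedType.Exports.

Local Open Scope classical_set_scope.
Local Open Scope ring_scope.

Section SmoothEuclidean.
Context {R : realType} {n : nat} {W : normedModType R}.

(* [A] is meant to be open: continuity and partial derivatives at the points
   of [A] then only depend on the values of [f] on [A], and [f] is allowed to
   take arbitrary values elsewhere. *)
Fixpoint Ck_on (k : nat) (A : set 'rV[R]_n) (f : 'rV[R]_n -> W) : Prop :=
  (forall x, A x -> {for x, continuous f}) /\
  if k is k'.+1 then
    forall j : 'I_n,
      (forall x, A x -> derivable f x (delta_mx 0 j)) /\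
      Ck_on k' A (fun x => 'D_(delta_mx 0 j) f x)
  else True.

Definition smooth_on (A : set 'rV[R]_n) (f : 'rV[R]_n -> W) : Prop :=
  forall k, Ck_on k A f.

Lemma Ck_on_continuous k A f : Ck_on k A f ->
  forall x, A x -> {for x, continuous f}.
Proof. by case: k => [|k] []. Qed.

Lemma Ck_onW k A f : Ck_on k.+1 A f -> Ck_on k A f.
Proof.
elim: k f => [|k IHk] f [cf Df]; first by split.
by split=> // j; have [df Dfj] := Df j; split=> //; exact: IHk.
Qed.

Lemma eq_Ck_on k A f g : open A -> (forall x, A x -> f x = g x) ->
  Ck_on k A f -> Ck_on k A g.
Proof.
move=> Ao; elim: k f g => [|k IHk] f g fg Cf.
all: have near_fg x : A x -> \forall y \near x, f y = g y
  by move=> Ax; apply: filterS fg _; exact: open_nbhs_nbhs.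
all: have cg x : A x -> {for x, continuous g}
  by move=> Ax; rewrite /prop_for /continuous_at -fg//;
     exact: cvg_trans (near_eq_cvg (near_fg x Ax)) (Ck_on_continuous Cf Ax).
  by split.
split=> // j; have [df Dfj] := Cf.2 j; split=> [x Ax|].
  exact: near_eq_derivable (near_fg x Ax) (df x Ax).
by apply: IHk Dfj => x Ax; exact: near_eq_derive (near_fg x Ax).
Qed.

Lemma Ck_on_cst k A (c : W) : Ck_on k A (cst c).
Proof.
elim: k c => [|k IHk] c; (split=> [x _|]; first exact: cst_continuous) => // j.
split=> [x _|]; first exact: derivable_cst.
rewrite (_ : (fun _ => _) = cst 0); first exact: IHk.
by apply/funext => x; rewrite derive_cst.
Qed.

Lemma Ck_onD k A f g : open A -> Ck_on k A f -> Ck_on k A g ->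
  Ck_on k A (f + g).
Proof.
move=> Ao; elim: k f g => [|k IHk] f g [cf Df] [cg Dg].
  by split=> // x Ax; exact: cvgD (cf x Ax) (cg x Ax).
split=> [x Ax|j]; first exact: cvgD (cf x Ax) (cg x Ax).
have [df Dfj] := Df j; have [dg Dgj] := Dg j.
split=> [x Ax|]; first by apply: derivableD; [exact: df|exact: dg].
apply: eq_Ck_on (IHk _ _ Dfj Dgj) => // x Ax.
by rewrite deriveD//; [exact: df|exact: dg].
Qed.

End SmoothEuclidean.

Lemma Ck_onM (R : realType) n k A (f g : 'rV[R]_n -> R) : open A ->
  Ck_on k A f -> Ck_on k A g -> Ck_on k A (f * g).
Proof.
move=> Ao; elim: k f g => [|k IHk] f g Cf Cg.
  split=> // x Ax.
  exact: cvgM (Ck_on_continuous Cf Ax) (Ck_on_continuous Cg Ax).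
split=> [x Ax|j].
  exact: cvgM (Ck_on_continuous Cf Ax) (Ck_on_continuous Cg Ax).
have [[_ /(_ j)[df Dfj]] [_ /(_ j)[dg Dgj]]] := (Cf, Cg).
split=> [x Ax|]; first by apply: derivableM; [exact: df|exact: dg].
apply: eq_Ck_on (Ck_onD Ao (IHk _ _ (Ck_onW Cf) Dgj)
                           (IHk _ _ (Ck_onW Cg) Dfj)) => // x Ax.
by rewrite deriveM//; [exact: df|exact: dg].
Qed.

(* [chart_map] and [chart_inv] are total functions whose values outside
   [chart_dom] and its image are irrelevant. *)
Record chart (R : realType) (M : topologicalType) := Chart {
  chart_dim : nat;
  chart_dom : set M;
  chart_map :> M -> 'rV[R]_chart_dim;
  chart_inv : 'rV[R]_chart_dim -> M;
  chart_dom_open : open chart_dom;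
  chart_img_open : open (chart_map @` chart_dom);
  chart_mapK : forall p, chart_dom p -> chart_inv (chart_map p) = p;
  chart_map_continuous : forall p, chart_dom p ->
    {for p, continuous chart_map};
  chart_inv_continuous : forall x, (chart_map @` chart_dom) x ->
    {for x, continuous chart_inv} }.

Arguments chart_dom {R M} c _ : rename.
Arguments chart_inv {R M} c _ : rename.
Arguments chart_img_open {R M} c : rename.

(* The smooth structure is given by an atlas that need not be maximal: smooth
   functions and maps are the same as for the maximal atlas it generates.
   The dimension is only locally constant, and the carrier may be empty. *)
Record smoothManifold (R : realType) := SmoothManifold {
  carrier :> topologicalType;
  atlas : set (chart R carrier);
  atlas_cover : forall p : carrier, exists2 c, atlas c & chart_dom c p;
  atlas_compatible : forall c d, atlas c -> atlas d ->
    smooth_on (c @` (chart_dom c `&` chart_dom d)) (d \o chart_inv c) }.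

Definition smooth_map (R : realType) (M N : smoothManifold R) (phi : M -> N) :=
  continuous phi /\
  forall c d, atlas c -> atlas d ->
    smooth_on (c @` (chart_dom c `&` phi @^-1` chart_dom d))
              (d \o phi \o chart_inv c).

Definition diffeomorphism (R : realType) (M N : smoothManifold R)
    (phi : M -> N) :=
  smooth_map phi /\
  exists psi : N -> M, [/\ cancel phi psi, cancel psi phi & smooth_map psi].

Definition smooth_real (R : realType) (M : smoothManifold R) (f : M -> R) :=
  forall c, atlas c -> smooth_on (c @` chart_dom c) (f \o chart_inv c).

Inductive scalar_kind := RealScalars | ComplexScalars.

Definition scalars (R : realType) (K : scalar_kind) : fieldType :=
  match K with RealScalars => R | ComplexScalars => R[i] end.

Definition smooth_fun (R : realType) (K : scalar_kind) (M : smoothManifold R) :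
    (M -> scalars R K) -> Prop :=
  match K with
  | RealScalars => fun f => smooth_real f
  | ComplexScalars => fun f =>
      smooth_real (fun p => complex.Re (f p)) /\
      smooth_real (fun p => complex.Im (f p))
  end.

Section SmoothFunctions.
Context (R : realType) (M : smoothManifold R).

Lemma smooth_real_cst (a : R) : smooth_real (fun _ : M => a).
Proof. by move=> c _ k; exact: Ck_on_cst. Qed.

Lemma smooth_realD (f g : M -> R) : smooth_real f -> smooth_real g ->
  smooth_real (fun p => f p + g p).
Proof.
move=> sf sg c cM k.
exact: (Ck_onD (chart_img_open c) (sf c cM k) (sg c cM k)).
Qed.

Lemma smooth_realM (f g : M -> R) : smooth_real f -> smooth_real g ->
  smooth_real (fun p => f p * g p).
Proof.
move=> sf sg c cM k.
exact: (Ck_onM (chart_img_open c) (sf c cM k) (sg c cM k)).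
Qed.

Lemma smooth_realN (f : M -> R) : smooth_real f ->
  smooth_real (fun p => - f p).
Proof.
move=> sf; rewrite (_ : (fun _ => _) = (fun p => -1 * f p)).
  by apply: smooth_realM => //; exact: smooth_real_cst.
by apply/funext => p; rewrite mulN1r.
Qed.

Context (K : scalar_kind).
Local Notation F := (scalars R K).

Lemma smooth_fun_cst (a : F) : smooth_fun (fun _ : M => a).
Proof. by case: K a => [|] /= a; [|split]; exact: smooth_real_cst. Qed.

Lemma smooth_funD (f g : M -> F) : smooth_fun f -> smooth_fun g ->
  smooth_fun (fun p => f p + g p).
Proof.
case: K f g => /= f g; first exact: smooth_realD.
move=> [sf1 sf2] [sg1 sg2]; split.
  rewrite (_ : (fun _ => _) = fun p => complex.Re (f p) + complex.Re (g p)).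
    exact: smooth_realD.
  by apply/funext => p; case: (f p); case: (g p).
rewrite (_ : (fun _ => _) = fun p => complex.Im (f p) + complex.Im (g p)).
  exact: smooth_realD.
by apply/funext => p; case: (f p); case: (g p).
Qed.

Lemma smooth_funM (f g : M -> F) : smooth_fun f -> smooth_fun g ->
  smooth_fun (fun p => f p * g p).
Proof.
case: K f g => /= f g; first exact: smooth_realM.
move=> [sf1 sf2] [sg1 sg2]; split.
  rewrite (_ : (fun _ => _) = fun p => complex.Re (f p) * complex.Re (g p) +
    - (complex.Im (f p) * complex.Im (g p))).
    by apply: smooth_realD; [|apply: smooth_realN]; exact: smooth_realM.
  by apply/funext => p; case: (f p); case: (g p).
rewrite (_ : (fun _ => _) = fun p => complex.Re (f p) * complex.Im (g p) +
    complex.Im (f p) * complex.Re (g p)).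
  by apply: smooth_realD; exact: smooth_realM.
by apply/funext => p; case: (f p); case: (g p).
Qed.

(* [F^o] is [F] seen as a module over itself; it makes [M -> F^o] an
   [F]-module with pointwise operations. *)
Definition smooth_pred : pred (M -> F^o) := fun f => `[< smooth_fun f >].

Lemma smooth_subring_closed : subring_closed smooth_pred.
Proof.
split=> [|f g /asboolP sf /asboolP sg|f g /asboolP sf /asboolP sg];
  apply/asboolP.
- exact: smooth_fun_cst.
- rewrite (_ : f - g = fun p => f p + -1 * g p).
    by apply: smooth_funD => //; apply: smooth_funM => //; exact: smooth_fun_cst.
  by apply/funext => p; rewrite mulN1r.
- exact: smooth_funM.
Qed.

Lemma smooth_scaler_closed : GRing.scaler_closed smooth_pred.
Proof.
move=> a f /asboolP sf; apply/asboolP.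
by apply: smooth_funM => //; exact: smooth_fun_cst.
Qed.

HB.instance Definition _ := GRing.isSubringClosed.Build _ smooth_pred
  smooth_subring_closed.
HB.instance Definition _ := GRing.isScaleClosed.Build F _ smooth_pred
  smooth_scaler_closed.

Record Cinf := MkCinf {
  Cinf_fun :> M -> F^o;
  Cinf_smooth : Cinf_fun \in smooth_pred }.

HB.instance Definition _ := [isSub for Cinf_fun].
HB.instance Definition _ := [Choice of Cinf by <:].
HB.instance Definition _ :=
  GRing.SubChoice_isSubComPzRing.Build _ _ Cinf (subringClosedP _).
HB.instance Definition _ := [SubZmodule_isSubLmodule of Cinf by <:].

Lemma CinfDE (f g : Cinf) p : (f + g) p = f p + g p :> F.
Proof. by []. Qed.

Lemma CinfME (f g : Cinf) p : (f * g) p = f p * g p :> F.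
Proof. by []. Qed.

Lemma Cinf1E p : (1 : Cinf) p = 1 :> F.
Proof. by []. Qed.

Lemma CinfZE (a : F) (f : Cinf) p : (a *: f) p = a * f p :> F.
Proof. by []. Qed.

Lemma CinfZAl (a : F) (f g : Cinf) : a *: (f * g) = (a *: f) * g.
Proof. by apply/val_inj/funext => p; exact: mulrA. Qed.

End SmoothFunctions.

Arguments Cinf {R} M K.

(* [Cinf M K] carries a commutative ring and an [F]-module structure rather than
   a [comAlgType] one, because the latter requires 1 != 0, which fails when [M]
   is empty. *)
Definition algebra_isomorphism (R : realType) (K : scalar_kind)
    (M1 M2 : smoothManifold R) (Phi : Cinf M1 K -> Cinf M2 K) :=
  [/\ linear Phi, {morph Phi : f g / f * g} & bijective Phi].

(* Main.v *)
Require Import Defs.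
From mathcomp Require Import all_boot all_order all_algebra.
From mathcomp Require Import all_classical all_reals all_analysis.
From mathcomp Require Import complex ring.

Set Implicit Arguments.
Unset Strict Implicit.
Unset Printing Implicit Defensive.

Import Order.TTheory GRing.Theory Num.Theory.
Import numFieldNormedType.Exports.

Local Open Scope classical_set_scope.
Local Open Scope ring_scope.

(** A character of the algebra of smooth functions need not be the evaluation at
    a point when the components of the manifold are as many as a measurable
    cardinal, so points are not recovered from all the characters.  They are
    recovered from the functions that have exactly one zero.

    Two smooth functions [f] and [g] have no common zero iff they generate the
    unit ideal: if they have none, [|f|^2 + |g|^2] lies in that ideal and is
    invertible ([comaximalP]).  Consequently [f] has exactly one zero iff the
    quotient of the algebra by [f] is a local ring ([local_quotientP]): if [p]
    is the only zero of [f], then [g] is invertible modulo [f] iff [g p] is not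
    0, whereas two zeros of [f] are separated by some [g] for which neither [g]
    nor [1 - g] is invertible modulo [f].  Both conditions are purely algebraic,
    and every point is the only zero of some smooth function: the difference
    between a bump function with a strict maximum there and its maximum value
    ([peak_function]).

    So, given an isomorphism [Phi], a point [q] of [M2] and a function [h]
    whose only zero is [q], the inverse image of [h] under [Phi] has a single
    zero, which is taken as [phi q].  A function [f] vanishing at [phi q] is not
    comaximal with that inverse image, so [Phi f] is not comaximal with [h],
    that is, [Phi f] vanishes at [q]; subtracting constants gives
    [Phi f q = f (phi q)] ([algebra_isomorphism_pullback]).  The inverse of
    [Phi] yields the inverse of [phi].

    A map that pulls smooth functions back to smooth functions is smooth
    ([smooth_map_pullback]), by localizing coordinates with bump functions.
    Bump functions are supported in compact subsets of a chart domain, which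
    are closed because the manifold is Hausdorff; no partition of unity, hence
    no paracompactness, is involved.  Complex scalars are treated together with
    real ones through the conjugation and the squared modulus. *)

(** * Differential calculus for functions of class C^k *)

Section CkCalculus.
Context {R : realType} {n : nat}.
Implicit Types (k : nat) (A B : set 'rV[R]_n).

Lemma Ck_onS (W : normedModType R) k A B (f : 'rV[R]_n -> W) :
  B `<=` A -> Ck_on k A f -> Ck_on k B f.
Proof.
move=> BA; elim: k f => [|k IHk] f [cf Df]; first by split=> // x /BA /cf.
split=> [x /BA /cf//|j]; have [df Dfj] := Df j.
by split=> [x /BA /df//|]; exact: IHk.
Qed.

(** All the clauses of [Ck_on] are conditions at single points on a globally
    defined function and its globally defined partial derivatives, so no
    openness is required to pass from local to global. *)
Lemma Ck_on_local (W : normedModType R) k A (f : 'rV[R]_n -> W) :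
  (forall x, A x -> exists2 B, B x & Ck_on k B f) -> Ck_on k A f.
Proof.
elim: k f => [|k IHk] f locf.
  by split=> // x /locf[B Bx /Ck_on_continuous]; exact.
split=> [x /locf[B Bx /Ck_on_continuous]|j]; first exact.
split=> [x /locf[B Bx [_ /(_ j)[df _]]]|]; first exact: df.
by apply: IHk => x /locf[B Bx [_ /(_ j)[_ Dfj]]]; exists B.
Qed.

(** The derivative of [1/g] is [- (1/g)^2 * Dg], a product of functions that are
    of class C^k when [1/g] is and [g] is of class C^(k+1). *)
Lemma Ck_onV k A (g : 'rV[R]_n -> R) : open A -> (forall x, A x -> g x != 0) ->
  Ck_on k A g -> Ck_on k A (fun x => (g x)^-1).
Proof.
move=> Ao gN0 Cg.
have cVg x : A x -> {for x, continuous (fun y => (g y)^-1)}.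
  move=> Ax; apply: (continuous_comp (Ck_on_continuous Cg Ax)).
  exact/inv_continuous/gN0.
elim: k Cg => [|k IHk] Cg; split=> // j.
have [dg Dgj] := Cg.2 j.
split=> [x Ax|]; first by apply: derivableV; [exact: gN0|exact: dg].
have CVg := IHk (Ck_onW Cg).
apply: eq_Ck_on (Ck_onM Ao (Ck_onM Ao (Ck_on_cst k A (-1 : R))
  (Ck_onM Ao CVg CVg)) Dgj) => // x Ax.
rewrite deriveV ?gN0//; last exact: dg.
rewrite -[LHS]/(-1 * ((g x)^-1 * (g x)^-1) * _).
by rewrite mulN1r -invfM -expr2.
Qed.

Lemma continuous_coord m (f : 'rV[R]_n -> 'rV[R]_m) (x : 'rV[R]_n) :
  (forall i, {for x, continuous (fun y => f y ord0 i)}) ->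
  {for x, continuous f}.
Proof.
move=> cf; apply: (cvgrPdist_le (FF := nbhs_filter x) f (f x)).2 => e e0.
have near_coord : \forall y \near x, forall i, `|f x ord0 i - f y ord0 i| <= e.
  apply: (@filter_forall _ _ _ _ (nbhs_filter x)) => i.
  exact: ((cvgrPdist_le (FF := nbhs_filter x) _ _).1 (cf i)).
apply: filterS near_coord => y fxy.
rewrite /Num.Def.normr/= mx_normrE (bigmax_le _ (ltW e0))//= => -[i j] _.
by rewrite !mxE/= ord1.
Qed.

Lemma Ck_on_coord m k A (f : 'rV[R]_n -> 'rV[R]_m) : open A ->
  Ck_on k A f <-> forall i, Ck_on k A (fun x => f x ord0 i).
Proof.
move=> Ao; elim: k f => [|k IHk] f.
  split=> [[cf _] i|cf]; split=> // x Ax.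
    exact: (@continuous_comp _ _ _ f (fun y : 'rV_m => y ord0 i) x (cf x Ax)
      (@coord_continuous R 1 m ord0 i (f x))).
  by apply: continuous_coord => i; have [+ _] := cf i; exact.
have Dcoord j x i : derivable f x (delta_mx 0 j) ->
    ('D_(delta_mx 0 j) f x) ord0 i = 'D_(delta_mx 0 j) (fun y => f y ord0 i) x.
  by move=> df; rewrite derive_mx// mxE.
split=> [[cf Df] i|Cf].
  split=> [x Ax|j].
    exact: (@continuous_comp _ _ _ f (fun y : 'rV_m => y ord0 i) x (cf x Ax)
      (@coord_continuous R 1 m ord0 i (f x))).
  have [df Dfj] := Df j.
  split=> [x Ax|]; first by have /derivable_mxP := df x Ax; exact.
  apply: eq_Ck_on ((IHk _).1 Dfj i) => // x Ax; rewrite Dcoord//; exact: df.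
have df j x : A x -> derivable f x (delta_mx 0 j).
  move=> Ax; apply/derivable_mxP => i' i; rewrite ord1.
  by have [_ /(_ j)[+ _]] := Cf i; exact.
split=> [x Ax|j].
  by apply: continuous_coord => i; exact: Ck_on_continuous (Cf i) _ Ax.
split=> [x|]; first exact: df.
apply/IHk => i; have [_ /(_ j)[_]] := Cf i.
by apply: eq_Ck_on => // x Ax; rewrite Dcoord//; exact: df.
Qed.

End CkCalculus.

(** A directional derivative is a derivative along a line, so the chain rule for
    functions of one real variable applies. *)
Lemma is_derive_scalar_comp (R : realType) (V : normedModType R)
    (g : V -> R) (h : R -> R) (x v : V) (dh : R) :
  derivable g x v -> is_derive (g x) 1 h dh ->
  is_derive x v (h \o g) (dh * 'D_v g x).
Proof.
move=> dg hdh; pose gamma t := g (t *: v + x).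
have gamma0 : gamma 0 = g x by rewrite /gamma scale0r add0r.
have derE (u : V -> R) : 'D_v u x = 'D_1 (fun t : R => u (t *: v + x)) 0.
  rewrite /derive; set q1 := fun t => t^-1 *: _; set q2 := fun t => t^-1 *: _.
  suff -> : q1 = q2 by [].
  by apply/funext => t; rewrite /q1 /q2/= addr0 scale0r add0r [_%:A]mulr1.
have dgamma : is_derive (0 : R) 1 gamma ('D_v g x).
  by rewrite derE; apply: derivableP; exact: ((derivable1P g x v).1 dg).
have hdh' : is_derive (gamma 0) 1 h dh by rewrite gamma0.
have [dhg Dhg] := is_derive1_comp hdh' dgamma.
by split; [exact: ((derivable1P (h \o g) x v).2 dhg)|rewrite derE; exact: Dhg].
Qed.

Lemma Ck_on_sum (R : realType) n (W : normedModType R) k (A : set 'rV[R]_n)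
    (I : Type) (r : seq I) (F : I -> 'rV[R]_n -> W) : open A ->
  (forall i, Ck_on k A (F i)) -> Ck_on k A (fun x => \sum_(i <- r) F i x).
Proof.
move=> Ao CF; elim: r => [|i r IHr].
  by rewrite (_ : (fun _ => _) = cst 0); [exact: Ck_on_cst|
    apply/funext => x; rewrite big_nil].
rewrite (_ : (fun _ => _) = F i + fun x => \sum_(j <- r) F j x).
  exact: Ck_onD.
by apply/funext => x; rewrite big_cons.
Qed.

(** * A flat bump profile *)

Section FlatFunction.
Context {R : realType}.

(** The powers of [s^-1] make this family, up to linear combinations, stable
    under differentiation; the member [n = 0] is the classical smooth function
    that is flat at 0, positive and increasing on the positive half-line. *)
Definition flat (n : nat) (s : R) : R :=
  if 0 < s then s^-1 ^+ n * expR (- s^-1) else 0.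

Lemma flat_le0 n s : s <= 0 -> flat n s = 0.
Proof. by rewrite /flat ltNge => ->. Qed.

Lemma flat_gt0 n s : 0 < s -> 0 < flat n s.
Proof.
by move=> s0; rewrite /flat s0 mulr_gt0 ?expR_gt0// exprn_gt0// invr_gt0.
Qed.

Lemma flat0_lt s t : s < t -> 0 < t -> flat 0 s < flat 0 t.
Proof.
move=> st t0; have [s0|s0] := leP s 0; first by rewrite flat_le0// flat_gt0.
by rewrite /flat s0 t0 !expr0 !mul1r ltr_expR ltrN2 ltf_pV2.
Qed.

(** The exponential dominates every power: [flat n] is bounded by a multiple
    of [s ^+ 2], which gives its derivative at 0. *)
Lemma flat_bound n s : `|flat n s| <= (n.+2)`!%:R * s ^+ 2.
Proof.
have [s0|s0] := leP s 0.
  by rewrite flat_le0// normr0 mulr_ge0 ?sqr_ge0.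
rewrite gtr0_norm ?flat_gt0// /flat s0.
have u0 : 0 < s^-1 by rewrite invr_gt0.
have fact0 : 0 < (n.+2)`!%:R :> R by rewrite ltr0n fact_gt0.
have expu : s^-1 ^+ n.+2 / (n.+2)`!%:R <= expR s^-1.
  by apply: le_trans (expR_ge1Dxn n.+1 (ltW u0)); rewrite lerDr.
rewrite expRN ler_pdivrMr ?expR_gt0//.
apply: le_trans (_ : (n.+2)`!%:R * s ^+ 2 * (s^-1 ^+ n.+2 / (n.+2)`!%:R) <= _).
  rewrite -addn2 exprD.
  have -> : (n + 2)`!%:R * s ^+ 2 * (s^-1 ^+ n * s^-1 ^+ 2 / (n + 2)`!%:R) =
     s^-1 ^+ n * ((n + 2)`!%:R / (n + 2)`!%:R) * (s * s^-1) ^+ 2 :> R by ring.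
  by rewrite !divff ?gt_eqF// ?addn2// expr1n !mulr1.
by apply: ler_wpM2l => //; rewrite mulr_ge0 ?sqr_ge0.
Qed.

Lemma is_derive_flat n (s : R) :
  is_derive s 1 (flat n) (flat n.+2 s - n%:R * flat n.+1 s).
Proof.
have [s0|s0|->] := ltgtP s 0.
- rewrite !flat_le0 ?ltW// mulr0 subr0.
  have near0 : \forall t \near s, cst 0 t = flat n t.
    have := lt_nbhsl s0; apply: filterS => t t0.
    by rewrite flat_le0// ltW.
  split; first exact: near_eq_derivable near0 (derivable_cst _ _ _).
  by rewrite -(near_eq_derive _ near0) derive_cst.
- pose w (t : R) := t^-1 ^+ n * expR (- t^-1).
  have nearw : \forall t \near s, w t = flat n t.
    by have := lt_nbhsr s0; apply: filterS => t t0; rewrite /flat t0.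
  have dV : is_derive s (1 : R) (fun t : R => t^-1) (- s ^- 2).
    apply: is_derive_eq; first exact: (is_deriveV (f := id) (lt0r_neq0 s0)).
    by rewrite [_%:A]mulr1.
  have dw : is_derive s 1 w (flat n.+2 s - n%:R * flat n.+1 s).
    have dX : is_derive s (1 : R) (fun t : R => t^-1 ^+ n)
        ((n%:R * s^-1 ^+ n.-1) *: (- s ^- 2)).
      rewrite (_ : (fun _ => _) = (fun t : R => t^-1) ^+ n).
        exact: is_deriveX.
      by apply/funext => t; rewrite exprfctE.
    have dE : is_derive s (1 : R) (fun t : R => expR (- t^-1))
        (expR (- s^-1) * s ^- 2).
      apply: (is_derive1_comp (f := expR)); rewrite -[s ^- 2]opprK.
      by apply: is_deriveN.
    have dXE := is_deriveM dX dE; apply: (is_derive_eq dXE).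
    rewrite /flat s0 /GRing.scale/= -!exprVn.
    by case: (n) => [|m]; rewrite ?mul0r//= ?[s^-1 ^+ _.+1]exprS; ring.
  split; first exact: near_eq_derivable nearw _.
  by rewrite -(near_eq_derive _ nearw) derive_val.
- have dq : (fun h : R => h^-1 *: (flat n (h *: 1 + 0) - flat n 0)) @ 0^' --> 0.
    have -> : (fun h : R => h^-1 *: (flat n (h *: 1 + 0) - flat n 0)) =
        fun h => h^-1 * flat n h.
      apply/funext => h.
      by rewrite addr0 [_%:A]mulr1 (flat_le0 _ (lexx 0)) subr0.
    apply/cvgr0Pnorm_le => e e0.
    pose C : R := (n.+2)`!%:R.
    have C0 : 0 < C by rewrite ltr0n fact_gt0.
    near=> h.
    have hN0 : h != 0 by near: h; exact: nbhs_dnbhs_neq.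
    rewrite normrM normfV ler_pdivrMl ?normr_gt0//.
    apply: le_trans (flat_bound n h) _; rewrite -/C.
    rewrite -(real_normK (num_real h)) expr2 mulrA mulrC ler_wpM2l//.
    rewrite -ler_pdivlMl// mulrC.
    by near: h; apply: dnbhs0_le; rewrite divr_gt0.
  rewrite !flat_le0// mulr0 subr0.
  split; first by apply/cvg_ex; exists 0.
  exact: cvg_lim dq.
Unshelve. all: by end_near. Qed.

(** A derivative of [flat n \o g] is a combination of compositions with
    [flat n.+1] and [flat n.+2], so the induction on [k] has [n] generalized. *)
Lemma Ck_on_flat m k (A : set 'rV[R]_m) n (g : 'rV[R]_m -> R) : open A ->
  Ck_on k A g -> Ck_on k A (fun x => flat n (g x)).
Proof.
move=> Ao; have cflat (l : nat) t : {for t, continuous (flat l)}.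
  apply: differentiable_continuous; apply/derivable1_diffP.
  by have [] := is_derive_flat l t.
have ccomp (l : nat) f x : {for x, continuous f} ->
    {for x, continuous (fun y : 'rV[R]_m => flat l (f y))}.
  move=> cf.
  exact: (@continuous_comp _ _ _ f (flat l) x cf (cflat l (f x))).
elim: k n g => [|k IHk] n g Cg.
  by split=> // x Ax; apply: ccomp; exact: Ck_on_continuous Cg _ Ax.
split=> [x Ax|j]; first by apply: ccomp; exact: Ck_on_continuous Cg _ Ax.
have [dg Dgj] := Cg.2 j.
have dcomp x : A x -> is_derive x (delta_mx 0 j) (flat n \o g)
    ((flat n.+2 (g x) - n%:R * flat n.+1 (g x)) * 'D_(delta_mx 0 j) g x).
  by move=> Ax; exact: is_derive_scalar_comp (dg x Ax) (is_derive_flat n (g x)).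
split=> [x Ax|]; first by have [] := dcomp x Ax.
have Cg' := Ck_onW Cg.
apply: eq_Ck_on (Ck_onM Ao (Ck_onD Ao (IHk n.+2 _ Cg')
  (Ck_onM Ao (Ck_on_cst k A (- n%:R : R)) (IHk n.+1 _ Cg'))) Dgj) => //.
move=> x Ax; rewrite [RHS](_ : _ = 'D_(delta_mx 0 j) (flat n \o g) x)//.
have [_ ->] := dcomp x Ax.
by rewrite -mulNr.
Qed.

End FlatFunction.

(** * Smooth functions and bump functions on a Hausdorff manifold *)

Section Manifold.
Context {R : realType} {M : smoothManifold R}.
Implicit Types (c d : chart R M) (u b : M -> R).

Lemma chart_img_openI c (V : set M) : open V -> open (c @` (chart_dom c `&` V)).
Proof.
move=> Vo; rewrite openE => _ [p [cp Vp] <-].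
have img_cp : (c @` chart_dom c) (c p) by exists p.
have near_img : \forall y \near c p, (c @` chart_dom c) y.
  by apply: open_nbhs_nbhs; split => //; exact: chart_img_open.
have near_V : \forall y \near c p, V (chart_inv c y).
  apply: (chart_inv_continuous img_cp).
  by rewrite chart_mapK//; apply: open_nbhs_nbhs.
apply: filterS2 near_img near_V => _ [p' cp' <-].
by rewrite chart_mapK// => Vp'; exists p'.
Qed.

Lemma smooth_real_continuous u : smooth_real u -> continuous u.
Proof.
move=> su p; have [c cM cp] := atlas_cover p.
have ucp : {for c p, continuous (u \o chart_inv c)}.
  by apply: (Ck_on_continuous (su c cM 0%N)); exists p.
have cuc := continuous_comp (chart_map_continuous cp) ucp.
have near_eq : \forall q \near p, (u \o chart_inv c \o c) q = u q.
  apply: filterS (open_nbhs_nbhs (conj (chart_dom_open c) cp)) => q cq.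
  by rewrite /= chart_mapK.
rewrite /continuous_at -(nbhs_singleton near_eq).
exact: cvg_trans (near_eq_cvg near_eq) cuc.
Qed.

Lemma smooth_real_inv u : (forall p, u p != 0) -> smooth_real u ->
  smooth_real (fun p => (u p)^-1).
Proof.
move=> uN0 su c cM k.
exact: (Ck_onV (chart_img_open c) (fun x _ => uN0 (chart_inv c x)) (su c cM k)).
Qed.

(** Extension by zero: the domain of [d] and the complement of [K] are two open
    sets covering [M], and the function is smooth on both. *)
Lemma smooth_real_extension d (K : set M) u : atlas d -> closed K ->
  K `<=` chart_dom d -> (forall p, ~ K p -> u p = 0) ->
  (forall c, atlas c ->
     smooth_on (c @` (chart_dom c `&` chart_dom d)) (u \o chart_inv c)) ->
  smooth_real u.
Proof.
move=> dM Kc Kd u0 su c cM k; apply: Ck_on_local => _ [p cp <-].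
have [dp|dNp] := pselect (chart_dom d p).
  exists (c @` (chart_dom c `&` chart_dom d)); first by exists p.
  exact: su.
exists (c @` (chart_dom c `&` ~` K)); first by exists p => //; split => // /Kd.
apply: eq_Ck_on (Ck_on_cst k _ (0 : R)).
  by apply: chart_img_openI; rewrite openC.
by move=> _ [q [cq Kq] <-]; rewrite /= chart_mapK// u0.
Qed.

(** Hausdorffness makes the compact set [K] closed, so that a function supported
    in one chart extends by zero to the manifold.  As long as it is
    positive, the profile is strictly decreasing in the Euclidean distance to
    [p0] measured in the chart, whence the strict maximum at [p0]. *)
Lemma bump_function (hM : hausdorff_space M) d (p0 : M) (U : set M) :
  atlas d -> chart_dom d p0 -> open U -> U p0 ->
  exists b, exists K : set M,
    [/\ closed K, K `<=` chart_dom d `&` U, forall p, ~ K p -> b p = 0 &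
        [/\ 0 < b p0, forall p, p <> p0 -> b p < b p0 & smooth_real b]].
Proof.
move=> dM dp0 Uo Up0.
have Vo := chart_img_openI (c := d) Uo; set V := d @` _ in Vo.
have Vx0 : V (d p0) by exists p0.
have /nbhs_ballP[r /= r0 rV] := open_nbhs_nbhs (conj Vo Vx0).
pose rho := r / 2.
have rho0 : 0 < rho by rewrite divr_gt0.
pose C := [set y : 'rV[R]_(chart_dim d) | `|d p0 - y| <= rho].
have CV : C `<=` V.
  move=> y Cy; apply: rV; rewrite -ball_normE /ball_/=.
  by apply: le_lt_trans Cy _; rewrite ltr_pdivrMr// ltr_pMr// ltr1n.
have Cc : compact C.
  apply: bounded_closed_compact; last first.
    have -> : C = closed_ball (d p0) rho by rewrite closed_ballE.
    exact: closed_ball_closed.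
  exists (`|d p0| + rho); split; first exact: num_real.
  move=> z ltz y Cy; apply: le_trans (ltW ltz).
  rewrite -[y](subKr (d p0)); apply: le_trans (ler_normB _ _) _.
  by rewrite lerD2l.
pose K := chart_inv d @` C.
have KdU : K `<=` chart_dom d `&` U.
  by move=> _ [y /CV[q [dq Uq] <-] <-]; rewrite chart_mapK.
have Kc : closed K.
  apply: (compact_closed hM); apply: continuous_compact Cc.
  apply: continuous_in_subspaceT => y /[!inE] /CV[q [dq _] <-].
  by apply: chart_inv_continuous; exists q.
pose sqdist p := \sum_(i < chart_dim d) (d p ord0 i - d p0 ord0 i) ^+ 2.
have sqdist_ge0 p : 0 <= sqdist p by apply: sumr_ge0 => i _; exact: sqr_ge0.
have coord_sqdist p i : `|d p0 ord0 i - d p ord0 i| ^+ 2 <= sqdist p.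
  rewrite /sqdist (bigD1 i)//= distrC real_normK ?num_real// lerDl.
  by apply: sumr_ge0 => j _; exact: sqr_ge0.
pose b p := if `[< chart_dom d p >] then flat 0 (rho ^+ 2 - sqdist p) else 0.
have bE p : chart_dom d p -> b p = flat 0 (rho ^+ 2 - sqdist p).
  by move=> dp; rewrite /b asboolT.
have bp0 : b p0 = flat 0 (rho ^+ 2).
  rewrite bE// (_ : sqdist p0 = 0) ?subr0// /sqdist big1// => i _.
  by rewrite subrr expr0n.
have b0 p : ~ K p -> b p = 0.
  move=> NKp; rewrite /b; case: asboolP => // dp; apply: flat_le0.
  rewrite leNgt; apply/negP => lt0.
  apply: NKp; exists (d p); last exact: chart_mapK.
  (* The norm on row vectors is the maximum norm, so it is bounded by the
     Euclidean norm. *)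
  rewrite /C/= /Num.Def.normr/= mx_normrE.
  rewrite (bigmax_le _ (ltW rho0))//= => -[i j] _.
  rewrite !mxE/= ord1 -(@ler_pXn2r _ 2) ?nnegrE ?normr_ge0 ?ltW//.
  apply: le_lt_trans (coord_sqdist p j) _.
  by rewrite -subr_gt0.
exists b, K; split=> //; split.
- by rewrite bp0 flat_gt0// exprn_gt0.
- move=> p pp0; rewrite bp0 /b.
  case: asboolP => dp; last by rewrite flat_gt0// exprn_gt0.
  apply: flat0_lt; last by rewrite exprn_gt0.
  rewrite ltrBlDr ltrDl lt_neqAle sqdist_ge0 andbT eq_sym.
  apply/eqP => sq0; apply: pp0; rewrite -(chart_mapK dp) -(chart_mapK dp0).
  congr (chart_inv d _); apply/rowP => i; apply/esym/eqP.
  rewrite -subr_eq0 -normr_eq0 -sqrf_eq0 eq_le exprn_ge0// andbT.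
  by have := coord_sqdist p i; rewrite sq0.
apply: (smooth_real_extension dM Kc _ b0) => [q /KdU[]//|c cM k].
have Ao : open (c @` (chart_dom c `&` chart_dom d)).
  by apply: chart_img_openI; exact: chart_dom_open.
have Cd := atlas_compatible cM dM k.
have Csq : Ck_on k (c @` (chart_dom c `&` chart_dom d)) (sqdist \o chart_inv c).
  rewrite (_ : _ \o _ = fun x => \sum_(i < chart_dim d)
    (((d \o chart_inv c) x ord0 i - d p0 ord0 i) *
     ((d \o chart_inv c) x ord0 i - d p0 ord0 i))).
    apply: Ck_on_sum => // i; apply: Ck_onM => //.
      apply: (Ck_onD Ao _ (Ck_on_cst k _ (- d p0 ord0 i))).
      exact: ((Ck_on_coord _ _ Ao).1 Cd).
    apply: (Ck_onD Ao _ (Ck_on_cst k _ (- d p0 ord0 i))).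
    exact: ((Ck_on_coord _ _ Ao).1 Cd).
  by apply/funext => x; rewrite /sqdist/=; apply: eq_bigr => i _; rewrite expr2.
have Cr : Ck_on k (c @` (chart_dom c `&` chart_dom d))
    (cst (rho ^+ 2) + (cst (-1) * (sqdist \o chart_inv c))).
  apply: Ck_onD => //; first exact: Ck_on_cst.
  by apply: Ck_onM => //; exact: Ck_on_cst.
apply: eq_Ck_on (Ck_on_flat 0 Ao Cr) => // _ [q [cq dq] <-].
rewrite /= chart_mapK// bE//; congr (flat 0 _).
rewrite -[LHS]/(rho ^+ 2 + -1 * sqdist (chart_inv c (c q))).
by rewrite chart_mapK// mulN1r.
Qed.

(** The coordinates of a chart are meaningful on its domain only; multiplied by a
    bump function supported there, they extend smoothly to the manifold. *)
Lemma smooth_real_coord d (K : set M) b i : atlas d -> closed K ->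
  K `<=` chart_dom d -> (forall p, ~ K p -> b p = 0) -> smooth_real b ->
  smooth_real (fun p => b p * d p ord0 i).
Proof.
move=> dM Kc Kd b0 sb; apply: (smooth_real_extension dM Kc Kd).
  by move=> p /b0 ->; rewrite mul0r.
move=> c cM k.
have Ao : open (c @` (chart_dom c `&` chart_dom d)).
  by apply: chart_img_openI; exact: chart_dom_open.
apply: (Ck_onM (f := b \o chart_inv c)
  (g := fun x => (d \o chart_inv c) x ord0 i) Ao).
  by apply: Ck_onS (sb c cM k) => _ [q [cq _] <-]; exists q.
by apply: ((Ck_on_coord _ _ Ao).1 _ i); exact: atlas_compatible.
Qed.

End Manifold.

(** A map is smooth as soon as it pulls smooth functions back to smooth
    functions.  Near a point, the coordinates of the map are quotients of the
    pullbacks of [b * d_i] and of [b], where [b] is a bump function supported in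
    the target chart [d]. *)
Lemma smooth_map_pullback (R : realType) (M N : smoothManifold R)
    (hN : hausdorff_space N) (phi : M -> N) :
  (forall u : N -> R, smooth_real u -> smooth_real (u \o phi)) ->
  smooth_map phi.
Proof.
move=> pull.
have cphi : continuous phi.
  move=> q U; rewrite nbhsE => -[V [Vo Vq] VU].
  have [d dN dq] := atlas_cover (phi q).
  have [b [K [_ KV b0 [bq _ sb]]]] := bump_function hN dN dq Vo Vq.
  have near_gt0 : \forall q' \near q, 0 < b (phi q').
    exact: (cvgr_gt (FF := nbhs_filter q) _
      (smooth_real_continuous (pull _ sb) (x := q)) _ bq).
  apply: filterS near_gt0 => q' bq'; apply: VU.
  have [/KV[]//|/b0 b0'] := pselect (K (phi q')).
  by move: bq'; rewrite b0' ltxx.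
split=> // c d cM dN k.
have Ao : open (c @` (chart_dom c `&` phi @^-1` chart_dom d)).
  apply: chart_img_openI; apply: open_comp => [q _|]; first exact: cphi.
  exact: chart_dom_open.
apply/(Ck_on_coord _ _ Ao) => i; apply: Ck_on_local => _ [q [cq dq] <-].
have [b [K [Kc KdT b0 [bq _ sb]]]] := bump_function hN dN dq openT I.
have Kd : K `<=` chart_dom d by move=> p /KdT[].
have sbphi := pull _ sb.
have sbdphi := pull _ (smooth_real_coord i dN Kc Kd b0 sb).
pose B := [set q' | b (phi q') != 0].
have Bo : open B.
  rewrite (_ : B = (b \o phi) @^-1` [set~ 0]).
    apply: open_comp; first by move=> q' _; exact: smooth_real_continuous.
    by rewrite openC; exact: closed_eq.
  by apply/seteqP; split => q' /= /eqP.
exists (c @` (chart_dom c `&` B)).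
  by exists q => //; split=> //; rewrite /B/= gt_eqF.
have BIo := chart_img_openI (c := c) Bo.
have BIc : c @` (chart_dom c `&` B) `<=` c @` chart_dom c.
  by move=> _ [q' [cq' _] <-]; exists q'.
have CV : Ck_on k (c @` (chart_dom c `&` B))
    (fun x => ((b \o phi \o chart_inv c) x)^-1).
  apply: Ck_onV => //; last exact: Ck_onS BIc (sbphi c cM k).
  by move=> _ [q' [cq' Bq'] <-] /=; rewrite chart_mapK.
apply: eq_Ck_on (Ck_onM BIo CV (Ck_onS BIc (sbdphi c cM k))) => //.
move=> _ [q' [cq' Bq'] <-].
pose y := phi (chart_inv c (c q')).
rewrite -[LHS]/((b y)^-1 * (b y * d y ord0 i)) /y.
by rewrite /= chart_mapK// mulKf.
Qed.

(** * Real and complex scalars *)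

Section Scalars.
Context {R : realType} {K : scalar_kind}.
Local Notation F := (scalars R K).

Definition scalar_of_real : R -> F :=
  match K with
  | RealScalars => fun x => x
  | ComplexScalars => fun x => Complex x 0
  end.

Definition scalar_Re : F -> R :=
  match K with
  | RealScalars => fun z => z
  | ComplexScalars => fun z => complex.Re z
  end.

Definition scalar_conj : F -> F :=
  match K with
  | RealScalars => fun z => z
  | ComplexScalars => fun z => Complex (complex.Re z) (- complex.Im z)
  end.

Definition scalar_sqnorm : F -> R :=
  match K with
  | RealScalars => fun z => z * z
  | ComplexScalars => fun z =>
      complex.Re z * complex.Re z + complex.Im z * complex.Im z
  end.

Lemma scalar_of_realK : cancel scalar_of_real scalar_Re.
Proof. by rewrite /scalar_of_real /scalar_Re; case: K. Qed.

Lemma scalar_of_realD x y :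
  scalar_of_real (x + y) = scalar_of_real x + scalar_of_real y.
Proof.
rewrite /scalar_of_real; case: K => //.
by apply/eqP; rewrite eq_complex/= addr0 !eqxx.
Qed.

Lemma scalar_of_realM x y :
  scalar_of_real (x * y) = scalar_of_real x * scalar_of_real y.
Proof.
rewrite /scalar_of_real; case: K => //.
by apply/eqP; rewrite eq_complex/= !(mulr0, mul0r) subr0 addr0 !eqxx.
Qed.

Lemma scalar_of_real0 : scalar_of_real 0 = 0.
Proof. by rewrite /scalar_of_real; case: K. Qed.

Lemma scalar_of_real1 : scalar_of_real 1 = 1.
Proof. by rewrite /scalar_of_real; case: K. Qed.

Lemma mul_scalar_conj z : scalar_conj z * z = scalar_of_real (scalar_sqnorm z).
Proof.
rewrite /scalar_conj /scalar_of_real /scalar_sqnorm; case: K z => // -[x y] /=.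
by apply/eqP; rewrite eq_complex/=; apply/andP; split; apply/eqP; ring.
Qed.

Lemma scalar_sqnorm_ge0 z : 0 <= scalar_sqnorm z.
Proof.
rewrite /scalar_sqnorm; case: K z => z; first by rewrite -expr2 sqr_ge0.
by rewrite addr_ge0// -expr2 sqr_ge0.
Qed.

Lemma scalar_sqnorm_eq0 z : scalar_sqnorm z = 0 -> z = 0.
Proof.
rewrite /scalar_sqnorm; case: K z => z /eqP.
  by rewrite mulf_eq0 orbb => /eqP.
rewrite paddr_eq0 -?expr2 ?sqr_ge0// !sqrf_eq0 => /andP[/eqP Rez /eqP Imz].
by apply/eqP; rewrite eq_complex Rez Imz !eqxx.
Qed.

Context {M : smoothManifold R}.

Lemma smooth_scalar_of_real (u : M -> R) :
  smooth_real u -> smooth_fun (fun p => scalar_of_real (u p)).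
Proof.
rewrite /scalar_of_real; case: K => //= su.
by split=> //; exact: smooth_real_cst.
Qed.

Lemma smooth_scalar_Re (f : M -> F) :
  smooth_fun f -> smooth_real (fun p => scalar_Re (f p)).
Proof. by rewrite /scalar_Re; case: K f => //= f []. Qed.

Lemma smooth_scalar_conj (f : M -> F) :
  smooth_fun f -> smooth_fun (fun p => scalar_conj (f p)).
Proof.
rewrite /scalar_conj; case: K f => //= f [Ref Imf].
by split=> //; exact: smooth_realN.
Qed.

Lemma smooth_scalar_sqnorm (f : M -> F) :
  smooth_fun f -> smooth_real (fun p => scalar_sqnorm (f p)).
Proof.
rewrite /scalar_sqnorm; case: K f => /= f.
  by move=> sf; exact: smooth_realM.
by move=> [Ref Imf]; apply: smooth_realD; exact: smooth_realM.
Qed.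

End Scalars.

Arguments scalar_of_real {R} K _.

(** * Functions with a single zero, algebraically *)

Definition comaximal (A : comPzRingType) (f g : A) :=
  exists a b : A, a * f + b * g = 1.

(** Says that the quotient of [A] by the ideal generated by [f] is a local ring,
    because a nonzero commutative ring is local iff, for each of its elements
    [x], one of [x] and [1 - x] is a unit. *)
Definition local_quotient (A : comPzRingType) (f : A) :=
  ~ comaximal f 0 /\ forall g, comaximal f g \/ comaximal f (1 - g).

Section SmoothAlgebra.
Context {R : realType} {K : scalar_kind} {M : smoothManifold R}.
Local Notation F := (scalars R K).
Implicit Types f g : Cinf M K.

Lemma smooth_Cinf f : smooth_fun (f : M -> F).
Proof. by have /asboolP := Cinf_smooth f. Qed.

Lemma exists_Cinf (f : M -> F) : smooth_fun f ->
  exists f' : Cinf M K, forall p, f' p = f p.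
Proof.
move=> sf; have sf' : (f : M -> F^o) \in @smooth_pred R M K by apply/asboolP.
by exists (MkCinf sf').
Qed.

Lemma Cinf_ext f g : (forall p, f p = g p) -> f = g.
Proof. by move=> fg; apply/val_inj/funext. Qed.

(** If [f] and [g] have no common zero then [|f|^2 + |g|^2] is invertible, and
    the ideal generated by [f] and [g] contains it. *)
Lemma comaximalP f g : comaximal f g <-> forall p, ~ (f p = 0 /\ g p = 0).
Proof.
split=> [[a [b abfg]] p [fp gp]|fgN0].
  have := congr1 (fun h : Cinf M K => h p : F) abfg.
  rewrite CinfDE !CinfME Cinf1E fp gp !mulr0 addr0 => /eqP.
  by rewrite eq_sym oner_eq0.
pose s p := scalar_sqnorm (f p : F) + scalar_sqnorm (g p : F).
have sN0 p : s p != 0.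
  rewrite /s paddr_eq0 ?scalar_sqnorm_ge0//.
  apply/negP => /andP[/eqP fp /eqP gp].
  by apply: (fgN0 p); split; exact: scalar_sqnorm_eq0.
have ss : smooth_real (fun p => (s p)^-1).
  apply: smooth_real_inv => //.
  apply: smooth_realD; apply: smooth_scalar_sqnorm.
    exact: (smooth_Cinf f).
  exact: (smooth_Cinf g).
have weight (h : Cinf M K) : exists a : Cinf M K, forall p,
    a p = scalar_of_real K (s p)^-1 * scalar_conj (h p : F).
  apply: exists_Cinf; apply: smooth_funM.
    exact: smooth_scalar_of_real.
  exact: (smooth_scalar_conj (smooth_Cinf h)).
have [[a aE] [b bE]] := (weight f, weight g).
exists a, b; apply: Cinf_ext => p.
rewrite CinfDE !CinfME Cinf1E aE bE -!mulrA !mul_scalar_conj -mulrDr.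
by rewrite -scalar_of_realD -scalar_of_realM mulVf// scalar_of_real1.
Qed.

(** The difference between the strict maximum of a bump function at [p] and that
    bump function. *)
Lemma peak_function (hM : hausdorff_space M) (p : M) :
  exists f, forall q, f q = 0 <-> q = p.
Proof.
have [d dM dp] := atlas_cover p.
have [b [_ [_ _ _ [_ bmax sb]]]] := bump_function hM dM dp openT I.
have [|f fE] := @exists_Cinf (fun q => scalar_of_real K (b p + - b q)).
  apply: smooth_scalar_of_real; apply: smooth_realD; last exact: smooth_realN.
  exact: smooth_real_cst.
exists f => q; rewrite fE.
split=> [fq0|->]; last by rewrite subrr scalar_of_real0.
apply: contrapT => /bmax; rewrite -subr_gt0.
have := scalar_of_realK (K := K) (b p - b q); rewrite fq0.
by rewrite -scalar_of_real0 scalar_of_realK => <-; rewrite ltxx.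
Qed.

(** Two zeros of [f] can be separated by some [g] that vanishes at one and is 1
    at the other, so that neither [g] nor [1 - g] is invertible modulo [f]. *)
Lemma local_quotientP (hM : hausdorff_space M) f :
  local_quotient f <-> exists p, forall q, f q = 0 <-> q = p.
Proof.
split=> [[fN0 floc]|[p fp]]; last first.
  split=> [/comaximalP/(_ p)[]|g]; first by split=> //; exact/fp.
  have [gp|gp] := pselect (g p = 0).
    right; apply/comaximalP => q [/fp -> /eqP].
    by rewrite -[(1 - g) p]/(1 - g p) gp subr0 oner_eq0.
  by left; apply/comaximalP => q [/fp ->].
have [p fp] : exists p, f p = 0.
  apply: contrapT => /forallNP fN; apply: fN0; apply/comaximalP => p [fp _].
  exact: (fN p).
exists p => q; split=> [fq|->//]; apply: contrapT => qp.
have [h hE] := peak_function hM p.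
have hq : h q != 0 :> F by apply/eqP => /hE.
pose g := (h q : F)^-1 *: h.
have gp : g p = 0 by rewrite /g CinfZE (hE p).2// mulr0.
have gq : g q = 1 by rewrite /g CinfZE mulVf.
case: (floc g) => /comaximalP; first by move=> /(_ p); exact.
by move=> /(_ q); apply; split=> //; rewrite -[(1 - g) q]/(1 - g q) gq subrr.
Qed.

End SmoothAlgebra.

(** * Algebra isomorphisms are pullbacks *)

Section AlgebraIsomorphism.
Context {R : realType} {K : scalar_kind} {M1 M2 : smoothManifold R}.
Context {Phi : Cinf M1 K -> Cinf M2 K}.

Lemma algebra_isomorphism_inv (Psi : Cinf M2 K -> Cinf M1 K) :
  algebra_isomorphism Phi -> cancel Phi Psi -> cancel Psi Phi ->
  algebra_isomorphism Psi.
Proof.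
move=> [linPhi mulPhi _] PhiK PsiK; split.
- by move=> a f g; apply: (can_inj PhiK); rewrite linPhi !PsiK.
- by move=> f g; apply: (can_inj PhiK); rewrite mulPhi !PsiK.
- by exists Phi.
Qed.

Lemma algebra_isomorphismD :
  algebra_isomorphism Phi -> {morph Phi : f g / f + g}.
Proof. by move=> [linPhi _ _] f g; rewrite -[f]scale1r linPhi !scale1r. Qed.

Lemma algebra_isomorphism1 : algebra_isomorphism Phi -> Phi 1 = 1.
Proof.
move=> [_ mulPhi [Psi _ PsiK]].
by rewrite -[LHS]mulr1 -{1}(PsiK 1) -mulPhi mul1r PsiK.
Qed.

Lemma algebra_isomorphism_comaximal f g : algebra_isomorphism Phi ->
  comaximal f g -> comaximal (Phi f) (Phi g).
Proof.
move=> isoPhi [a [b abfg]]; exists (Phi a), (Phi b).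
have [_ mulPhi _] := isoPhi.
rewrite -!mulPhi -(algebra_isomorphismD isoPhi) abfg.
exact: algebra_isomorphism1.
Qed.

End AlgebraIsomorphism.

Section Pullback.
Context {R : realType} {K : scalar_kind} {M1 M2 : smoothManifold R}.
Context {Phi : Cinf M1 K -> Cinf M2 K} {Psi : Cinf M2 K -> Cinf M1 K}.
Context (isoPhi : algebra_isomorphism Phi).
Context (PhiK : cancel Phi Psi) (PsiK : cancel Psi Phi).
Local Notation F := (scalars R K).

Lemma algebra_isomorphism_comaximalE f g :
  comaximal (Phi f) (Phi g) <-> comaximal f g.
Proof.
split=> [|fg]; last exact: algebra_isomorphism_comaximal.
have isoPsi := algebra_isomorphism_inv isoPhi PhiK PsiK.
by move=> /(algebra_isomorphism_comaximal isoPsi); rewrite !PhiK.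
Qed.

Lemma algebra_isomorphism_local_quotient f :
  local_quotient (Phi f) -> local_quotient f.
Proof.
have Phi0 : Phi 0 = 0.
  by apply: (addrI (Phi 0)); rewrite -(algebra_isomorphismD isoPhi) !addr0.
move=> [fN0 floc]; split=> [|g].
  by rewrite -algebra_isomorphism_comaximalE Phi0.
case: (floc (Phi g)); first by move=> /algebra_isomorphism_comaximalE; left.
have -> : 1 - Phi g = Phi (1 - g).
  apply/(addIr (Phi g)); rewrite -(algebra_isomorphismD isoPhi) !subrK.
  by rewrite (algebra_isomorphism1 isoPhi).
by move=> /algebra_isomorphism_comaximalE; right.
Qed.

(** The image of [q] is the unique zero of the element of [Cinf M1 K] that
    corresponds to a function vanishing at [q] only.  Vanishing at a point is
    failure of comaximality with a function whose only zero it is, so [Phi]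
    preserves it, and by linearity it preserves values. *)
Lemma algebra_isomorphism_pullback (hM1 : hausdorff_space M1)
    (hM2 : hausdorff_space M2) :
  exists phi : M2 -> M1, forall (f : Cinf M1 K) q, Phi f q = f (phi q).
Proof.
have image q : exists p, forall f : Cinf M1 K, Phi f q = f p.
  have [h hE] := @peak_function R K M2 hM2 q.
  have [p pE] : exists p, forall p', (Psi h) p' = 0 <-> p' = p.
    apply/(local_quotientP hM1); apply: algebra_isomorphism_local_quotient.
    by rewrite PsiK; apply/(local_quotientP hM2); exists q.
  have zero (f : Cinf M1 K) : f p = 0 -> Phi f q = 0.
    move=> fp; apply: contrapT => Phifq.
    have : comaximal (Phi f) (Phi (Psi h)).
      rewrite PsiK; apply/comaximalP => q' [Phifq' /hE q'q].
      by apply: Phifq; rewrite -q'q.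
    move=> /algebra_isomorphism_comaximalE/comaximalP/(_ p); apply.
    by split=> //; exact/pE.
  (* Subtracting the value of [f] at [p] reduces to the case of a zero. *)
  exists p => f; pose c : F := f p.
  have := zero (- c *: (1 : Cinf M1 K) + f : Cinf M1 K).
  rewrite CinfDE CinfZE Cinf1E mulr1 addNr => /(_ erefl).
  have [linPhi _ _] := isoPhi.
  rewrite linPhi (algebra_isomorphism1 isoPhi) CinfDE CinfZE Cinf1E mulr1.
  by move/eqP; rewrite addrC subr_eq0 => /eqP.
have [phi phiE] := choice image.
by exists phi => f q.
Qed.

End Pullback.

Lemma pullback_smooth_map (R : realType) (K : scalar_kind)
    (M1 M2 : smoothManifold R) (hM1 : hausdorff_space M1)
    (Phi : Cinf M1 K -> Cinf M2 K) (phi : M2 -> M1) :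
  (forall (f : Cinf M1 K) q, Phi f q = f (phi q)) -> smooth_map phi.
Proof.
move=> phiE; apply: (smooth_map_pullback hM1) => u su.
have [f fE] := exists_Cinf (smooth_scalar_of_real (K := K) su).
rewrite (_ : u \o phi = fun q => scalar_Re (Phi f q : scalars R K)).
  exact: (smooth_scalar_Re (smooth_Cinf (Phi f))).
by apply/funext => q; rewrite phiE fE scalar_of_realK.
Qed.

(** Functions with a single zero separate the points, so an identity between
    maps can be tested on their pullbacks. *)
Lemma pullback_cancel (R : realType) (K : scalar_kind)
    (M1 M2 : smoothManifold R) (hM1 : hausdorff_space M1)
    (Phi : Cinf M1 K -> Cinf M2 K) (Psi : Cinf M2 K -> Cinf M1 K)
    (phi : M2 -> M1) (psi : M1 -> M2) : cancel Phi Psi ->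
  (forall (f : Cinf M1 K) q, Phi f q = f (phi q)) ->
  (forall (g : Cinf M2 K) p, Psi g p = g (psi p)) ->
  cancel psi phi.
Proof.
move=> PhiK phiE psiE p.
have [f fE] := @peak_function R K M1 hM1 p.
by apply/fE; rewrite -phiE -psiE PhiK; exact/fE.
Qed.

Theorem theorem1 (R : realType) (K : scalar_kind) (M1 M2 : smoothManifold R)
    (hM1 : hausdorff_space M1) (hM2 : hausdorff_space M2)
    (Phi : Cinf M1 K -> Cinf M2 K) (hPhi : algebra_isomorphism Phi) :
  exists2 phi : M2 -> M1, diffeomorphism phi &
    forall (f : Cinf M1 K) (q : M2), Phi f q = f (phi q).
Proof.
have [_ _ [Psi PhiK PsiK]] := hPhi.
have hPsi := algebra_isomorphism_inv hPhi PhiK PsiK.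
have [phi phiE] := algebra_isomorphism_pullback hPhi PhiK PsiK hM1 hM2.
have [psi psiE] := algebra_isomorphism_pullback hPsi PsiK PhiK hM2 hM1.
exists phi => //; split; first exact: pullback_smooth_map phiE.
exists psi; split; last exact: pullback_smooth_map psiE.
- exact: (pullback_cancel hM2 PsiK psiE phiE).
- exact: (pullback_cancel hM1 PhiK phiE psiE).
Qed.
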